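(* Let $\Gamma$ be a plane curve with finite arclength $L(\Gamma)>0$, let $$f(X):=\frac{1}{L(\Gamma)}\int_\Gamma d(X,Y)\,dY\qquad (X\in\mathbb{R}^2),$$ and let $c$ be a real number such that the level set $f^{-1}(c)$ is nonempty. Then the generalized conic $f^{-1}(c)=\{X\in\mathbb{R}^2 : f(X)=c\}$ is the limit, with respect to the Hausdorff distance, of a sequence of polyellipses.
   Context: $d$ denotes the Euclidean distance in the plane and the integral over $\Gamma$ is taken with respect to arclength. Given finitely many not necessarily different points $F_1,\ldots,F_m$ ($m\ge 1$) in the plane and a real number $c'$, the set $\{X\in\mathbb{R}^2 : \sum_{i=1}^m d(X,F_i)=c'\}$ (assumed nonempty) is called a polyellipse with focuses $F_1,\ldots,F_m$. The Hausdorff distance of nonempty compact sets $K,L\subset\mathbb{R}^2$ is $h(K,L)=\max\{\max_{X\in K}\min_{Y\in L}d(X,Y),\ \max_{Y\in L}\min_{X\in K}d(X,Y)\}$. *)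

(* Defs.v *)
From HB Require Import structures.
From mathcomp Require Import all_boot all_order all_algebra.
From mathcomp Require Import all_classical all_reals all_analysis.
From mathcomp Require Import ring.

Set Implicit Arguments.
Unset Strict Implicit.
Unset Printing Implicit Defensive.

Import Order.TTheory GRing.Theory Num.Theory.
Import numFieldNormedType.Exports.

Local Open Scope classical_set_scope.
Local Open Scope ring_scope.

(* The library's norm on R * R is the max norm, hence the explicit Euclidean
   distance; both induce the same topology. *)
Definition edist2 (R : realType) (X Y : R * R) : R :=
  Num.sqrt ((X.1 - Y.1) ^+ 2 + (X.2 - Y.2) ^+ 2).

(* Length of the polygon with vertices gamma a, gamma s_0, gamma s_1, ... *)
Fixpoint polygon_length (R : realType) (gamma : R -> R * R) (a : R)
    (s : seq R) : R :=
  if s is x :: s' then edist2 (gamma a) (gamma x) + polygon_length gamma x s'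
  else 0.

(* Arclength: supremum of the lengths of the inscribed polygons. *)
Definition arclength (R : realType) (gamma : R -> R * R) (a b : R) : \bar R :=
  ereal_sup [set (polygon_length gamma a s)%:E | s in itv_partition a b].

(* A plane curve is a continuous path; it may be closed or self-intersecting,
   and no differentiability is required.  The values of curve_fun outside
   [curve_lo, curve_hi] are irrelevant. *)
Record rectifiable_curve (R : realType) := RectifiableCurve {
  curve_fun :> R -> R * R;
  curve_lo : R;
  curve_hi : R;
  curve_le : curve_lo <= curve_hi;
  curve_continuous : {within `[curve_lo, curve_hi], continuous curve_fun};
  curve_finite : (arclength curve_fun curve_lo curve_hi < +oo)%E }.

Definition curve_length (R : realType) (G : rectifiable_curve R) : R :=
  fine (arclength G (curve_lo G) (curve_hi G)).

(* The parameter is clamped to [curve_lo, curve_hi], so that the associated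
   Stieltjes measure has no mass outside this interval. *)
Definition arclength_fun (R : realType) (G : rectifiable_curve R) (t : R) : R :=
  fine (arclength G (curve_lo G)
          (Num.min (curve_hi G) (Num.max (curve_lo G) t))).

Section arclength_theory.
Context {R : realType}.
Implicit Types (g : R -> R * R) (a b c x y : R) (s : seq R).

Lemma edist2_ge0 (X Y : R * R) : 0 <= edist2 X Y.
Proof. exact: sqrtr_ge0. Qed.

Lemma edist2_fst (X Y : R * R) : `|Y.1 - X.1| <= edist2 X Y.
Proof.
by rewrite distrC -sqrtr_sqr ler_sqrt ?lerDl ?addr_ge0 ?sqr_ge0.
Qed.

Lemma edist2_snd (X Y : R * R) : `|Y.2 - X.2| <= edist2 X Y.
Proof.
by rewrite distrC -sqrtr_sqr ler_sqrt ?lerDr ?addr_ge0 ?sqr_ge0.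
Qed.

Lemma edist2_le (X Y : R * R) : edist2 X Y <= `|Y.1 - X.1| + `|Y.2 - X.2|.
Proof.
rewrite -[leRHS]ger0_norm ?addr_ge0// -[leRHS]sqrtr_sqr ler_sqrt ?sqr_ge0//.
rewrite [leRHS]sqrrD !real_normK ?num_real// addrAC -subr_ge0.
set w := `|_| * _; have w0 : 0 <= w by rewrite mulr_ge0.
suff -> : (Y.1 - X.1) ^+ 2 + (Y.2 - X.2) ^+ 2 + w *+ 2 -
  ((X.1 - Y.1) ^+ 2 + (X.2 - Y.2) ^+ 2) = w *+ 2 by rewrite mulrn_wge0.
ring.
Qed.

Lemma edist2_triangle (Y X Z : R * R) : edist2 X Z <= edist2 X Y + edist2 Y Z.
Proof.
rewrite /edist2.
set p := X.1 - Y.1; set q := X.2 - Y.2.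
set u := Y.1 - Z.1; set v := Y.2 - Z.2.
have -> : X.1 - Z.1 = p + u by rewrite /p /u addrA subrK.
have -> : X.2 - Z.2 = q + v by rewrite /q /v addrA subrK.
have pq0 : 0 <= p ^+ 2 + q ^+ 2 by rewrite addr_ge0 ?sqr_ge0.
have uv0 : 0 <= u ^+ 2 + v ^+ 2 by rewrite addr_ge0 ?sqr_ge0.
set A := Num.sqrt (p ^+ 2 + _); set B := Num.sqrt (u ^+ 2 + _).
have A0 : 0 <= A by exact: sqrtr_ge0.
have B0 : 0 <= B by exact: sqrtr_ge0.
rewrite -[leRHS]ger0_norm ?addr_ge0// -[leRHS]sqrtr_sqr ler_sqrt ?sqr_ge0//.
have AE : A ^+ 2 = p ^+ 2 + q ^+ 2 by rewrite sqr_sqrtr.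
have BE : B ^+ 2 = u ^+ 2 + v ^+ 2 by rewrite sqr_sqrtr.
have CS : p * u + q * v <= A * B.
  rewrite (le_trans (ler_norm _))// -sqrtr_sqr.
  rewrite -[leRHS]ger0_norm ?mulr_ge0// -(sqrtr_sqr (A * B)).
  rewrite ler_sqrt ?sqr_ge0// exprMn AE BE -subr_ge0.
  have -> : (p ^+ 2 + q ^+ 2) * (u ^+ 2 + v ^+ 2) - (p * u + q * v) ^+ 2 =
    (p * v - q * u) ^+ 2 by ring.
  exact: sqr_ge0.
have -> : (p + u) ^+ 2 + (q + v) ^+ 2 =
  (p ^+ 2 + q ^+ 2) + (u ^+ 2 + v ^+ 2) + (p * u + q * v) *+ 2 by ring.
rewrite -AE -BE sqrrD addrAC lerD2r lerD2l.
by rewrite lerMn2r CS orbT.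
Qed.

Lemma polygon_length_ge0 g a s : 0 <= polygon_length g a s.
Proof. by elim: s a => //= x s ih a; rewrite addr_ge0// edist2_ge0. Qed.

Lemma polygon_length_cat g a b s s' : itv_partition a b s ->
  polygon_length g a (s ++ s') = polygon_length g a s + polygon_length g b s'.
Proof.
elim: s a => [a /itv_partition_nil -> /=|x s ih a /itv_partition_cons abs /=].
  by rewrite add0r.
by rewrite ih// addrA.
Qed.

Lemma polygon_length_split g a b c s : itv_partition a b s -> a <= c -> c <= b ->
  exists s1 s2, [/\ itv_partition a c s1, itv_partition c b s2 &
    polygon_length g a s <= polygon_length g a s1 + polygon_length g c s2].
Proof.
elim: s a => [a /itv_partition_nil ->|x s ih a abs ac cb].
  move=> bc cb; have -> : c = b by apply/eqP; rewrite eq_le cb bc.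
  exists [::], [::]; rewrite /itv_partition/= addr0.
  by split.
have ax : a < x by case: abs => /= /andP[].
have xbs := itv_partition_cons abs.
have [xc|cx] := leP x c.
  have [s1 [s2 [p1 p2 h]]] := ih _ xbs xc cb.
  exists (x :: s1), s2; split => //.
    by case: p1 => p1 l1; split => //=; rewrite ax.
  by rewrite /= -addrA lerD2l.
move: ac; rewrite le_eqVlt => /predU1P[<-|ac].
  by exists [::], (x :: s); split => //=; rewrite add0r.
exists [:: c], (x :: s); split; first exact: itv_partition1.
  by case: abs => /= /andP[_ p] l; split => //=; rewrite cx.
by rewrite /= addr0 addrA lerD2r edist2_triangle.
Qed.

Lemma polygon_length_variation g a b s : itv_partition a b s ->
  [/\ variation a b (fst \o g) s <= polygon_length g a s,
      variation a b (snd \o g) s <= polygon_length g a s &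
      polygon_length g a s <=
        variation a b (fst \o g) s + variation a b (snd \o g) s].
Proof.
rewrite /variation; elim: s a => [|x s ih] a abs.
  by rewrite /= !big_nat !big_pred0// addr0.
have [h1 h2 h3] := ih _ (itv_partition_cons abs).
rewrite /= !big_nat_recl//=; split.
- by rewrite lerD// edist2_fst.
- by rewrite lerD// edist2_snd.
- by rewrite addrACA lerD// edist2_le.
Qed.

Lemma arclength_ge0 g a b : a <= b -> (0 <= arclength g a b)%E.
Proof.
rewrite le_eqVlt => /predU1P[<-|ab].
  by apply: ereal_sup_ubound; exists [::].
apply: le_trans (ereal_sup_ubound _); last first.
  by exists [:: b]; first exact: itv_partition1.
by rewrite lee_fin polygon_length_ge0.
Qed.

Lemma arclength_le g a b c : a <= c -> c <= b ->
  (arclength g a c <= arclength g a b)%E.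
Proof.
move=> ac; rewrite le_eqVlt => /predU1P[->//|cb].
apply: ge_ereal_sup => _ [s acs <-].
apply: (@le_trans _ _ (polygon_length g a (s ++ [:: b]))%:E).
  by rewrite lee_fin (polygon_length_cat _ _ acs) lerDl polygon_length_ge0.
apply: ereal_sup_ubound; exists (s ++ [:: b]) => //.
by apply: itv_partition_cat acs _; exact: itv_partition1.
Qed.

Lemma arclength_subadd g a b c : a <= c -> c <= b ->
  (arclength g a b <= arclength g a c + arclength g c b)%E.
Proof.
move=> ac cb; apply: ge_ereal_sup => _ [s abs <-].
have [s1 [s2 [p1 p2 h]]] := polygon_length_split g abs ac cb.
apply: (@le_trans _ _ ((polygon_length g a s1)%:E +
                       (polygon_length g c s2)%:E)%E) => //.
by apply: leeD; apply: ereal_sup_ubound; [exists s1|exists s2].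
Qed.

Lemma arclength_le_total_variation g a b :
  (arclength g a b <= total_variation a b (fst \o g) +
                      total_variation a b (snd \o g))%E.
Proof.
apply: ge_ereal_sup => _ [s abs <-].
have [_ _ h] := polygon_length_variation g abs.
apply: (@le_trans _ _ ((variation a b (fst \o g) s)%:E +
                       (variation a b (snd \o g) s)%:E)%E) => //.
by apply: leeD; apply: ereal_sup_ubound; eexists;
  [exact: variations_variation abs|by []|exact: variations_variation abs|by []].
Qed.

Lemma arclength_bounded_variation g a b : (arclength g a b < +oo)%E ->
  bounded_variation a b (fst \o g) /\ bounded_variation a b (snd \o g).
Proof.
move=> fin; have H s : itv_partition a b s ->
    polygon_length g a s <= fine (arclength g a b).
  move=> abs; have le : ((polygon_length g a s)%:E <= arclength g a b)%E.
    by apply: ereal_sup_ubound; exists s.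
  by rewrite -lee_fin fineK// fin_real// fin (lt_le_trans (ltNyr _) le).
split; exists (fine (arclength g a b)) => _ [s abs <-];
  rewrite (le_trans _ (H _ abs))//; by case: (polygon_length_variation g abs).
Qed.

End arclength_theory.

Section arclength_cumulative.
Context {R : realType} (G : rectifiable_curve R).

Let lo := curve_lo G.
Let hi := curve_hi G.
Let clamp (t : R) := Num.min hi (Num.max lo t).
Let lohi : lo <= hi := curve_le G.

Let clamp_lo t : lo <= clamp t.
Proof. by rewrite le_min lohi le_max lexx. Qed.

Let clamp_hi t : clamp t <= hi.
Proof. by rewrite ge_min lexx. Qed.

Let clamp_id t : lo <= t -> t <= hi -> clamp t = t.
Proof. by move=> lt th; rewrite /clamp max_r// min_r. Qed.

Let clamp_le s t : s <= t -> clamp s <= clamp t.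
Proof. by move=> st; rewrite /clamp le_min2// le_max2. Qed.

Let arclength_fin t : lo <= t -> t <= hi -> arclength G lo t \is a fin_num.
Proof.
move=> lt th; rewrite ge0_fin_numE; last exact: arclength_ge0.
exact: le_lt_trans (arclength_le G lt th) (curve_finite G).
Qed.

Lemma arclength_fun_nd : nondecreasing (arclength_fun G).
Proof.
have fin t : arclength G lo (clamp t) \is a fin_num.
  by apply: arclength_fin; [exact: clamp_lo|exact: clamp_hi].
move=> s t st; apply: (fine_le (fin s) (fin t)).
by apply: arclength_le; [exact: clamp_lo|exact: clamp_le].
Qed.

Let right_cvg (p : R * R -> R) x : continuous p -> lo <= x -> x < hi ->
  (p \o G) @ x^'+ --> (p \o G) x.
Proof.
move=> cp lx xh.
have xhG : {within `[x, hi], continuous (p \o G)}.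
  apply: (@continuous_subspaceW _ _ _ `[lo, hi]).
    by apply: subset_itvr; rewrite bnd_simp.
  move=> y; apply: (@continuous_comp (subspace `[lo, hi]) _ _ G p); last exact: cp.
  exact: curve_continuous.
by have /(continuous_within_itvP _ xh)[] := xhG.
Qed.

Lemma arclength_fun_rc : right_continuous (arclength_fun G).
Proof.
move=> x; have [hx|xh] := leP hi x.
  apply: cvg_near_cst; near=> t; congr (fine (arclength _ _ _)).
  have xt : x <= t by [].
  rewrite -/lo -/hi !min_l// le_max ?hx ?orbT//.
  by rewrite (le_trans hx xt) orbT.
have [xlo|lx] := ltP x lo.
  apply: cvg_near_cst; near=> t; congr (fine (arclength _ _ _)).
  have tlo : t <= lo by near: t; exact: nbhs_right_le.
  by rewrite -/lo -/hi !max_l// ltW.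
have [bv1 bv2] := arclength_bounded_variation (curve_finite G).
pose V1 t := fine (total_variation lo t (fst \o G)).
pose V2 t := fine (total_variation lo t (snd \o G)).
have cV1 : V1 t @[t --> x^'+] --> V1 x.
  apply: (total_variation_right_continuous lx xh) => //.
  by apply: (@right_cvg fst) => // ?; exact: cvg_fst.
have cV2 : V2 t @[t --> x^'+] --> V2 x.
  apply: (total_variation_right_continuous lx xh) => //.
  by apply: (@right_cvg snd) => // ?; exact: cvg_snd.
have cU : arclength_fun G x + ((V1 t - V1 x) + (V2 t - V2 x))
    @[t --> x^'+] --> arclength_fun G x.
  rewrite -[X in _ --> X]addr0; apply: cvgD; first exact: cvg_cst.
  rewrite -[X in _ --> X]addr0; apply: cvgD.
    by rewrite -(subrr (V1 x)); apply: cvgB => //; exact: cvg_cst.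
  by rewrite -(subrr (V2 x)); apply: cvgB => //; exact: cvg_cst.
apply: squeeze_cvgr (cvg_cst _) cU; near=> t.
have xt : x <= t by [].
have th : t <= hi by near: t; exact: nbhs_right_le.
rewrite arclength_fun_nd//=.
have lt : lo <= t := le_trans lx xt.
rewrite /arclength_fun -/(clamp x) -/(clamp t) !clamp_id//; last exact: ltW.
have fin1 y : lo <= y -> y <= hi ->
    total_variation lo y (fst \o G) \is a fin_num.
  by move=> ly yh; apply/(bounded_variationP _ ly)/(bounded_variationl ly yh).
have fin2 y : lo <= y -> y <= hi ->
    total_variation lo y (snd \o G) \is a fin_num.
  by move=> ly yh; apply/(bounded_variationP _ ly)/(bounded_variationl ly yh).
have xh' := ltW xh.
rewrite -lee_fin 2!EFinD !EFinB /V1 /V2 !fineK ?fin1 ?fin2 ?arclength_fin//.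
rewrite (total_variationD _ lx xt) (total_variationD (snd \o G) lx xt).
rewrite [X in (_ <= _ + (X + _))%E]addeAC subee ?fin1// add0e.
rewrite [X in (_ <= _ + (_ + X))%E]addeAC subee ?fin2// add0e.
apply: le_trans (arclength_subadd G lx xt) _.
by rewrite leeD2l// arclength_le_total_variation.
Unshelve. all: by end_near. Qed.

HB.instance Definition _ :=
  isCumulative.Build R _ R (arclength_fun G) arclength_fun_nd arclength_fun_rc.

End arclength_cumulative.

(* Integral of u over G with respect to arclength, that is the Stieltjes
   integral of u \o G against d(arclength_fun G). *)
Definition arclength_integral (R : realType) (G : rectifiable_curve R)
    (u : R * R -> R) : R :=
  \int[lebesgue_stieltjes_measure (arclength_fun G)]_(t in
    `[curve_lo G, curve_hi G]) u (G t).

Definition mean_distance (R : realType) (G : rectifiable_curve R)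
    (X : R * R) : R :=
  (curve_length G)^-1 * arclength_integral G (edist2 X).

Definition is_polyellipse (R : realType) (P : set (R * R)) : Prop :=
  P !=set0 /\
  exists (m : nat) (F : 'I_m -> R * R) (c' : R),
    (0 < m)%N /\ P = [set X | \sum_(i < m) edist2 X (F i) = c'].

(* For nonempty compact sets the suprema and infima are attained, and this is
   the usual max-min formula. *)
Definition hausdorff_distance (R : realType) (K L : set (R * R)) : \bar R :=
  maxe (ereal_sup [set ereal_inf [set (edist2 X Y)%:E | Y in L] | X in K])
       (ereal_sup [set ereal_inf [set (edist2 X Y)%:E | X in K] | Y in L]).

(* Main.v *)
Require Import Defs.
From HB Require Import structures.
From mathcomp Require Import all_boot all_order all_algebra.
From mathcomp Require Import all_classical all_reals all_analysis.
From mathcomp Require Import measurable_realfun ring lra.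
Set Implicit Arguments.
Unset Strict Implicit.
Unset Printing Implicit Defensive.
Import Order.TTheory GRing.Theory Num.Theory.
Import numFieldNormedType.Exports.
Local Open Scope classical_set_scope.
Local Open Scope ring_scope.

(* The mean distance f is convex and is uniformly approximated by means f_m of
   finitely many distances: cut the curve into m arcs of equal length and put a
   focus on each arc.  If c is not the minimum of f, convexity makes f cross the
   level c with a slope bounded below along rays from a point where f < c, so
   the c-level of f_m is close to that of f.  If c is the minimum of f, the
   level set is a single point, itself a polyellipse: the distance function to a
   point Y is strictly convex along a segment unless Y lies on the line through
   it, outside its interior, and a connected curve inside this set lies on one
   side of the segment, where f is not constant on the segment. *)

(** * Arclength as a continuous parameter, and the measure it induces *)

Section arclength_parameter.
Context {R : realType} (G : rectifiable_curve R).

Local Notation lo := (curve_lo G).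
Local Notation hi := (curve_hi G).
Local Notation L := (curve_length G).
Local Notation F := (arclength_fun G).

Lemma arclength_funE t : lo <= t -> t <= hi -> (F t)%:E = arclength G lo t.
Proof.
move=> lt th; rewrite /arclength_fun (max_r lt) (min_r th) fineK//.
rewrite ge0_fin_numE; last exact: arclength_ge0.
exact: le_lt_trans (arclength_le G lt th) (curve_finite G).
Qed.

Lemma arclength_fun_lo t : t <= lo -> F t = 0.
Proof.
move=> tl; rewrite /arclength_fun (max_l tl) (min_r (curve_le G)).
have := arclength_le_total_variation G lo lo.
rewrite !total_variationxx adde0 => h.
by rewrite (_ : arclength _ _ _ = 0%E)//; apply/eqP; rewrite eq_le h arclength_ge0.
Qed.

Lemma arclength_fun_hi : F hi = L.
Proof. by rewrite /arclength_fun (max_r (curve_le G)) minxx. Qed.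

(** Appending the vertex [G t] to any polygon inscribed up to [s] adds the chord to its length; take
    the supremum over such polygons. *)
Lemma edist2_le_arclength s t : lo <= s -> s <= t -> t <= hi ->
  edist2 (G s) (G t) <= F t - F s.
Proof.
move=> ls; rewrite le_eqVlt => /predU1P[<- _|st th].
  by rewrite subrr /edist2 !subrr expr0n/= addr0 sqrtr0.
have lt := le_trans ls (ltW st); have sh := le_trans (ltW st) th.
rewrite lerBrDl -lee_fin EFinD arclength_funE// addeC.
rewrite -leeBrDl// arclength_funE//.
apply: ge_ereal_sup => _ [p ap <-]; rewrite leeBrDl//.
apply: le_trans (ereal_sup_ubound _); last first.
  exists (p ++ [:: t]) => //.
  by apply: itv_partition_cat ap _; exact: itv_partition1.
by rewrite (polygon_length_cat _ _ ap)/= addr0 EFinD addeC.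
Qed.

(** The increments of [F] are dominated by those of [V], the sum of the variations of the two
    coordinates, and [V] is continuous because the coordinates are continuous and of bounded
    variation. *)
Lemma arclength_fun_continuous : lo < hi -> {within `[lo, hi], continuous F}.
Proof.
move=> lh.
have [bv1 bv2] := arclength_bounded_variation (curve_finite G).
have cG (p : R * R -> R) : continuous p -> {within `[lo, hi], continuous (p \o G)}.
  move=> cp y; apply: (@continuous_comp (subspace `[lo, hi]) _ _ G p).
    exact: curve_continuous.
  exact: cp.
have c1 := total_variation_continuous lh (cG fst (fun=> cvg_fst)) bv1.
have c2 := total_variation_continuous lh (cG snd (fun=> cvg_snd)) bv2.
pose V t := fine (total_variation lo t (fst \o G)) +
            fine (total_variation lo t (snd \o G)).
have cV : {within `[lo, hi], continuous V} by move=> x; apply: cvgD; [exact: c1|exact: c2].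
have FV s t : lo <= s -> s <= t -> t <= hi -> F t - F s <= V t - V s.
  move=> ls st th.
  have lt := le_trans ls st; have sh := le_trans st th.
  have fin1 y : lo <= y -> y <= hi ->
      total_variation lo y (fst \o G) \is a fin_num.
    by move=> ly yh; apply/(bounded_variationP _ ly)/(bounded_variationl ly yh).
  have fin2 y : lo <= y -> y <= hi ->
      total_variation lo y (snd \o G) \is a fin_num.
    by move=> ly yh; apply/(bounded_variationP _ ly)/(bounded_variationl ly yh).
  have h : (arclength G lo t <= arclength G lo s +
      (total_variation s t (fst \o G) + total_variation s t (snd \o G)))%E.
    apply: le_trans (arclength_subadd G ls st) _.
    by rewrite leeD2l// arclength_le_total_variation.
  have e1 := total_variationD (fst \o G) ls st.
  have e2 := total_variationD (snd \o G) ls st.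
  have g1 : total_variation s t (fst \o G) \is a fin_num.
    move: (fin1 t lt th); rewrite e1 fin_numD => /andP[] //.
  have g2 : total_variation s t (snd \o G) \is a fin_num.
    move: (fin2 t lt th); rewrite e2 fin_numD => /andP[] //.
  move: h; rewrite -!arclength_funE// -(fineK g1) -(fineK g2) -!EFinD lee_fin.
  rewrite /V e1 e2 !fineD ?fin1 ?fin2//; lra.
apply/subspace_continuousP => x /= xI.
move/subspace_continuousP : cV => /(_ x xI) cV.
apply/cvgrPdist_lt => e e0.
move/cvgrPdist_lt : cV => /(_ e e0).
rewrite !near_withinE; apply: filterS => t + tI => /(_ tI).
move: xI tI; rewrite /= !in_itv/= => /andP[lx xh] /andP[lt th].
apply: le_lt_trans; have [xt|/ltW tx] := leP x t.
  rewrite distrC (distrC (V x)) !ger0_norm ?FV// subr_ge0.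
    by rewrite -subr_ge0; apply: le_trans (FV _ _ lx xt th); rewrite subr_ge0 arclength_fun_nd.
  by rewrite arclength_fun_nd.
rewrite !ger0_norm ?FV// subr_ge0.
  by rewrite -subr_ge0; apply: le_trans (FV _ _ lt tx xh); rewrite subr_ge0 arclength_fun_nd.
by rewrite arclength_fun_nd.
Qed.

Local Notation mu := (lebesgue_stieltjes_measure F).

Lemma arclength_measure_itvoc s t : s <= t -> mu `]s, t]%classic = (F t - F s)%:E.
Proof.
move=> st; rewrite /lebesgue_stieltjes_measure /measure_extension/=.
rewrite measurable_mu_extE/= ?wlength_itv_bnd//; exact: is_ocitv.
Qed.

(** Clamping makes [F] vanish to the left of [lo], so even []lo - 1, lo]] is null. This allows
    passing from closed intervals to half-open ones, which split without overlap. *)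
Lemma arclength_measure_lo : mu [set lo] = 0%E.
Proof.
apply/eqP; rewrite eq_le measure_ge0 andbT.
apply: (@le_trans _ _ (mu `](lo - 1), lo]%classic)).
  apply: le_measure; rewrite ?inE//.
  by move=> x /= ->; rewrite in_itv/= lexx gtrBl ltr01.
by rewrite arclength_measure_itvoc ?gerBl ?ler01// !arclength_fun_lo ?subrr ?gerBl ?ler01.
Qed.

Lemma continuous_curve_integrable (u : R * R -> R) (i : interval R) :
  continuous u -> [set` i] `<=` `[lo, hi]%classic ->
  mu.-integrable [set` i] (EFin \o (u \o G)).
Proof.
move=> cu ilh.
have cuG : {within `[lo, hi], continuous (u \o G)}.
  move=> y; apply: (@continuous_comp (subspace `[lo, hi]) _ _ G u).
    exact: curve_continuous.
  exact: cu.
apply: (@integrableS _ _ _ mu _ _ (EFin \o (u \o G) : measurableTypeR R -> _)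
  (measurable_itv `[lo, hi]) (measurable_itv i) ilh).
apply: measurable_bounded_integrable => //.
- apply: (@le_lt_trans _ _ (mu `](lo - 1), hi]%classic)).
    apply: le_measure; rewrite ?inE//.
    by apply: subset_itvr; rewrite bnd_simp gtrBl ltr01.
  rewrite arclength_measure_itvoc ?ltry//.
  by rewrite (le_trans _ (curve_le G))// gerBl ler01.
- exact: subspace_continuous_measurable_fun.
- have /compact_bounded[M [_ mrt]] := continuous_compact cuG (@segment_compact _ _ _).
  by exists M; split; rewrite ?num_real // => ? ? ? ?; exact: mrt.
Qed.

End arclength_parameter.

(** * Euclidean distance and its behaviour along lines *)

Section euclidean_distance.
Context {R : realType}.
Implicit Types (X Y Z : R * R) (t k : R).

Lemma edist2C X Y : edist2 X Y = edist2 Y X.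
Proof. by rewrite /edist2 -[in LHS]sqrrN opprB -[X in _ + X]sqrrN opprB. Qed.

Lemma edist2xx X : edist2 X X = 0.
Proof. by rewrite /edist2 !subrr expr0n/= addr0 sqrtr0. Qed.

Lemma edist2_eq0 X Y : edist2 X Y = 0 -> X = Y.
Proof.
move=> h; have := edist2_fst X Y; have := edist2_snd X Y.
rewrite h !normr_le0 !subr_eq0 => /eqP e2 /eqP e1.
by case: X Y e1 e2 {h} => [a b] [a' b'] /= -> ->.
Qed.

Lemma edist2_scale k (X Y X' Y' : R * R) : 0 <= k ->
  X'.1 - Y'.1 = k * (X.1 - Y.1) -> X'.2 - Y'.2 = k * (X.2 - Y.2) ->
  edist2 X' Y' = k * edist2 X Y.
Proof.
move=> k0 e1 e2; rewrite /edist2 e1 e2 !exprMn -mulrDr sqrtrM ?sqr_ge0//.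
by rewrite sqrtr_sqr ger0_norm.
Qed.

Lemma edist2_sqr X Y : edist2 X Y ^+ 2 = (X.1 - Y.1) ^+ 2 + (X.2 - Y.2) ^+ 2.
Proof. by rewrite sqr_sqrtr// addr_ge0 ?sqr_ge0. Qed.

Lemma edist2_lipschitz X Y Z : `|edist2 X Y - edist2 X Z| <= edist2 Y Z.
Proof.
rewrite ler_norml; apply/andP; split.
  by rewrite lerBrDl -lerBrDr opprK edist2_triangle.
rewrite lerBlDl (edist2C Y); exact: edist2_triangle.
Qed.

Lemma edist2_continuous X : continuous (edist2 X).
Proof.
move=> Y; apply: (@continuous_comp _ _ _
  (fun Y : R * R => (X.1 - Y.1) ^+ 2 + (X.2 - Y.2) ^+ 2) Num.sqrt).
  apply: cvgD; under eq_fun do rewrite expr2; rewrite expr2; apply: cvgM;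
    apply: cvgB; by [exact: cvg_cst|exact: cvg_fst|exact: cvg_snd].
exact: sqrt_continuous.
Qed.

(** The parameter is not confined to [[0, 1]]: points beyond [Y] are needed to cross a level from
    below to above. *)
Definition line X Y t : R * R :=
  (X.1 + t * (Y.1 - X.1), X.2 + t * (Y.2 - X.2)).

Lemma line1 X Y : line X Y 1 = Y.
Proof. by rewrite /line !mul1r !subrKC; case: Y. Qed.

Lemma lineK X Y t : t != 0 -> line X (line X Y t) t^-1 = Y.
Proof. by move=> t0; case: X Y => a b [a' b']; rewrite /line/=; congr pair; field. Qed.

Lemma edist2_line X Y s t :
  edist2 (line X Y s) (line X Y t) = `|s - t| * edist2 X Y.
Proof.
wlog st : s t / t <= s => [wlg|].
  by have [/wlg//|/ltW/wlg h] := leP t s; rewrite edist2C h distrC.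
rewrite edist2C ger0_norm ?subr_ge0//; apply: edist2_scale; rewrite ?subr_ge0//=; ring.
Qed.

Lemma edist2_convex X Y Z t : 0 <= t <= 1 ->
  edist2 (line X Y t) Z <= (1 - t) * edist2 X Z + t * edist2 Y Z.
Proof.
move=> /andP[t0 t1]; apply: (le_trans (edist2_triangle (line Z Y t) _ _)).
apply: lerD; rewrite le_eqVlt; apply/orP; left; apply/eqP;
  apply: edist2_scale; rewrite ?subr_ge0//=; ring.
Qed.

End euclidean_distance.

(* By the parallelogram identity, equality forces Z onto the line through P and
   Q, outside the open segment. *)
Lemma edist2_midpoint_eq (R : realType) (P Q Z : R * R) :
  edist2 P Z + edist2 Q Z = 2 * edist2 (line P Q 2^-1) Z ->
  `|edist2 Q Z - edist2 P Z| = edist2 P Q.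
Proof.
move=> /(congr1 (fun x => x ^+ 2)); rewrite exprMn edist2_sqr/= => h.
have := edist2_sqr P Z; have := edist2_sqr Q Z; have := edist2_sqr P Q.
set p := edist2 P Z in h *; set q := edist2 Q Z in h * => ePQ eq ep.
rewrite -sqrtr_sqr -[RHS]ger0_norm ?edist2_ge0// -[RHS]sqrtr_sqr; congr Num.sqrt.
rewrite ePQ; move: h eq ep; clearbody p q; lra.
Qed.

Lemma lipschitz_real_continuous (R : realType) (h : R -> R) (D : R) :
  (forall s t, `|h s - h t| <= `|s - t| * D) -> continuous h.
Proof.
move=> hD x; apply/cvgrPdist_lt => e e0.
(* [D] may vanish, so a positive majorant is used as divisor. *)
have D1 : 0 < `|D| + 1 by rewrite ltr_wpDl.
near=> y; apply: (le_lt_trans (hD _ _)).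
apply: (@le_lt_trans _ _ (`|x - y| * (`|D| + 1))).
  by rewrite ler_wpM2l// (le_trans (ler_norm _))// lerDl.
rewrite -ltr_pdivlMr//; near: y.
by apply: (@cvgr_dist_lt _ _ _ _ _ id); [exact: cvg_id|rewrite divr_gt0].
Unshelve. all: by end_near. Qed.

Lemma continuousZ_real (R : realType) (k : R) (u : R * R -> R) :
  continuous u -> continuous (fun Y => k * u Y).
Proof. by move=> cu Y; apply: cvgM; [exact: cvg_cst|exact: cu]. Qed.

Lemma continuousD_real (R : realType) (u v : R * R -> R) :
  continuous u -> continuous v -> continuous (fun Y => u Y + v Y).
Proof. by move=> cu cv Y; apply: cvgD; [exact: cu|exact: cv]. Qed.

(* Both the mean over a curve and the mean over finitely many points are
   normalised positive linear functionals A, and X |-> A (edist2 X) is the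
   corresponding mean distance. *)
Definition is_mean (R : realType) (A : (R * R -> R) -> R) : Prop :=
  [/\ forall u v : R * R -> R, continuous u -> continuous v ->
        A (fun Y => u Y + v Y) = A u + A v,
      forall k (u : R * R -> R), continuous u -> A (fun Y => k * u Y) = k * A u,
      forall u v : R * R -> R, continuous u -> continuous v -> (forall Y, u Y <= v Y) ->
        A u <= A v
    & A (fun=> 1) = 1].

(** * Convexity, Lipschitz bound and growth of mean distances *)

Section mean_of_distances.
Context {R : realType} (A : (R * R -> R) -> R) (mA : is_mean A).
Implicit Types (X Y : R * R) (t : R).

Lemma mean_cst k : A (fun=> k) = k.
Proof.
have [_ mZ _ m1] := mA.
have := mZ k (fun=> 1) (@cst_continuous _ _ _); by rewrite m1 !mulr1.
Qed.

Lemma mean_convex X Y t : 0 <= t <= 1 ->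
  A (edist2 (line X Y t)) <= (1 - t) * A (edist2 X) + t * A (edist2 Y).
Proof.
have [mD mZ mle _] := mA.
have cX := @edist2_continuous R X; have cY := @edist2_continuous R Y.
move=> t01; rewrite -!mZ// -mD; [|exact: continuousZ_real..].
apply: mle; [exact: edist2_continuous| |by move=> Z; exact: edist2_convex].
by apply: continuousD_real; exact: continuousZ_real.
Qed.

Lemma mean_lipschitz X Y : `|A (edist2 X) - A (edist2 Y)| <= edist2 X Y.
Proof.
have [mD mZ mle _] := mA.
suff h X' Y' : A (edist2 X') <= edist2 X' Y' + A (edist2 Y').
  by rewrite ler_norml lerBlDr h andbT lerBrDl -lerBrDr opprK addrC edist2C h.
rewrite -[X in X + _]mean_cst -mD; [|exact: cst_continuous|exact: edist2_continuous].
apply: mle; [exact: edist2_continuous| |by move=> Z; exact: edist2_triangle].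
by apply: continuousD_real; [exact: cst_continuous|exact: edist2_continuous].
Qed.

(** Average the triangle inequality through [Z] over all [Z]. This is what bounds the level sets. *)
Lemma edist2_le_mean X Y : edist2 X Y <= A (edist2 X) + A (edist2 Y).
Proof.
have [mD mZ mle _] := mA.
have cX := @edist2_continuous R X; have cY := @edist2_continuous R Y.
rewrite -[X in X <= _]mean_cst -mD//.
apply: mle; [exact: cst_continuous|exact: continuousD_real|move=> Z].
by rewrite (edist2C Y) edist2_triangle.
Qed.

End mean_of_distances.

(* Along the ray from x0 through X, convexity makes f cross the level c with
   slope at least (c - f x0) / edist2 x0 X; a function within e of f thus
   reaches the level c near X. *)
Lemma nearby_level_point (R : realType) (A B : (R * R -> R) -> R) (e c : R)
    (x0 X : R * R) : is_mean A -> is_mean B ->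
  (forall Y, `|A (edist2 Y) - B (edist2 Y)| <= e) ->
  A (edist2 x0) < c -> e <= c - A (edist2 x0) -> A (edist2 X) = c ->
  exists2 Y, B (edist2 Y) = c &
    edist2 X Y <= e / (c - A (edist2 x0)) * edist2 x0 X.
Proof.
move=> mA mB AB x0c ec Xc.
have e0 : 0 <= e := le_trans (normr_ge0 _) (AB X).
set d := c - A (edist2 x0); have d0 : 0 < d by rewrite subr_gt0.
set s := e / d; have s0 : 0 <= s by rewrite divr_ge0// ltW.
have s1 : s <= 1 by rewrite ler_pdivrMr// mul1r.
have sd : s * d = e by rewrite divfK// gt_eqF.
pose h t := B (edist2 (line x0 X t)).
have ch : continuous h.
  apply: (@lipschitz_real_continuous _ _ (edist2 x0 X)) => a b.
  by rewrite -edist2_line mean_lipschitz.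
(* Convexity between [x0] and [X] puts the [A]-mean at most [c - s * d = c - e] here. *)
have h1 : h (1 - s) <= c.
  have := mean_convex mA x0 X (t := 1 - s).
  rewrite subr_ge0 s1 gerBl s0 => /(_ isT).
  have := AB (line x0 X (1 - s)); rewrite ler_norml => /andP[+ _].
  rewrite -/(h _) Xc; move: sd; rewrite /d; nra.
(* Now [X] lies between [x0] and the point of parameter [1 + s], so convexity forces the [A]-mean
   there to be at least [c + s * d = c + e]. *)
have h2 : c <= h (1 + s).
  have s10 : 0 < 1 + s by rewrite ltr_wpDr.
  have := mean_convex mA x0 (line x0 X (1 + s)) (t := (1 + s)^-1).
  rewrite lineK ?gt_eqF// Xc invr_ge0 (ltW s10) invf_le1// lerDl s0 => /(_ isT).
  rewrite -(ler_pM2l s10) mulrDr !mulrA mulrBr mulr1 divff ?gt_eqF// mul1r.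
  have := AB (line x0 X (1 + s)); rewrite ler_norml => /andP[_].
  rewrite -/(h _); move: sd; rewrite /d; nra.
have s1s : 1 - s <= 1 + s by rewrite lerD2l; lra.
have [|t] := IVT s1s (continuous_subspaceT ch) (v := c).
  by rewrite ge_min h1 le_max h2 orbT.
rewrite in_itv/= => /andP[ts1 ts2] htc.
exists (line x0 X t) => //.
rewrite -[X in edist2 X _](line1 x0) edist2_line ler_wpM2r ?edist2_ge0//.
by rewrite ler_norml; apply/andP; split; lra.
Qed.

(** * Hausdorff distance between level sets of close means *)

Section hausdorff.
Context {R : realType} (K K' : set (R * R)).

Lemma hausdorff_distance_le (e : R) :
  (forall X, K X -> exists2 Y, K' Y & edist2 X Y <= e) ->
  (forall Y, K' Y -> exists2 X, K X & edist2 X Y <= e) ->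
  (hausdorff_distance K K' <= e%:E)%E.
Proof.
move=> h1 h2; rewrite /hausdorff_distance ge_max; apply/andP; split;
    apply: ge_ereal_sup => _ [X KX <-]; apply: ge_ereal_inf.
  have [Y KY XY] := h1 _ KX; exists (edist2 X Y)%:E; first by exists Y.
  by rewrite lee_fin.
have [Y KY XY] := h2 _ KX; exists (edist2 Y X)%:E; first by exists Y.
by rewrite lee_fin.
Qed.

Lemma hausdorff_distance_ge0 : K !=set0 -> (0 <= hausdorff_distance K K')%E.
Proof.
move=> [X KX]; rewrite /hausdorff_distance le_max; apply/orP; left.
apply: le_trans (ereal_sup_ubound _); last by exists X; [exact: KX|reflexivity].
by apply: le_ereal_inf_tmp => _ [Y _ <-]; rewrite lee_fin edist2_ge0.
Qed.

End hausdorff.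

(** [nearby_level_point] is applied in both directions. The condition on [e] keeps [x0] at least
    [d / 2] below the level for [B] too, and points of either level set lie within [2 * c] of [x0];
    the constant is [2 * c] divided by [d / 2]. *)
Lemma level_set_hausdorff_le (R : realType) (A B : (R * R -> R) -> R) (e c : R)
    (x0 : R * R) : is_mean A -> is_mean B ->
  (forall Y, `|A (edist2 Y) - B (edist2 Y)| <= e) ->
  A (edist2 x0) < c -> 2 * e <= c - A (edist2 x0) ->
  (hausdorff_distance [set X | B (edist2 X) = c] [set X | A (edist2 X) = c]
     <= (4 * c / (c - A (edist2 x0)) * e)%:E)%E.
Proof.
move=> mA mB AB x0c ec.
have e0 : 0 <= e := le_trans (normr_ge0 _) (AB x0).
set d := c - A (edist2 x0); have d0 : 0 < d by rewrite subr_gt0.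
rewrite -/d in ec.
have /ler_normlP[Bx1 Bx2] := AB x0.
have xB : B (edist2 x0) < c by move: d0 ec; rewrite -/d /d; lra.
have dB : d / 2 <= c - B (edist2 x0) by move: ec; rewrite -/d /d; lra.
have c0 : 0 <= c.
  apply: le_trans (ltW x0c); apply: le_trans (edist2_ge0 x0 x0) _.
  have := edist2_le_mean mA x0 x0; rewrite edist2xx; lra.
have dist2c (C : (R * R -> R) -> R) X : is_mean C -> C (edist2 x0) < c ->
    C (edist2 X) = c -> edist2 x0 X <= 2 * c.
  by move=> mC x0C XC; have := edist2_le_mean mC x0 X; rewrite XC; lra.
have bound k r : d / 2 <= k -> r <= 2 * c -> e / k * r <= 4 * c / d * e.
  move=> dk rc; have k0 : 0 < k by apply: lt_le_trans dk; rewrite divr_gt0.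
  apply: (@le_trans _ _ (e / k * (2 * c))); first by rewrite ler_wpM2l// divr_ge0// ltW.
  rewrite (_ : 4 * c / d * e = e / (d / 2) * (2 * c)); last first.
    by field; rewrite gt_eqF.
  rewrite ler_wpM2r ?mulr_ge0// ler_wpM2l// lef_pV2// posrE// divr_gt0//.
apply: hausdorff_distance_le => X /= Xc.
  have [||Y Yc XY] := @nearby_level_point _ B A e c x0 X mB mA _ xB _ Xc.
  - by move=> Y; rewrite distrC.
  - by apply: le_trans dB; lra.
  exists Y => //; apply: le_trans XY _; apply: bound => //; exact: dist2c Xc.
have [|Y Yc XY] := @nearby_level_point _ A B e c x0 X mA mB AB x0c _ Xc.
  by rewrite -/d; lra.
exists Y => //; rewrite edist2C; apply: le_trans XY _.
by apply: bound; [rewrite -/d; lra|exact: dist2c Xc].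
Qed.

(** * The mean over a curve and its discretization *)

Section curve_mean.
Context {R : realType} (G : rectifiable_curve R).

Local Notation lo := (curve_lo G).
Local Notation hi := (curve_hi G).
Local Notation L := (curve_length G).
Local Notation F := (arclength_fun G).
Local Notation mu := (lebesgue_stieltjes_measure F).

(** At [edist2 X] this unfolds to [mean_distance G X]; leaving the integrand free makes linearity
    and monotonicity available. *)
Definition curve_mean (u : R * R -> R) : R := L^-1 * arclength_integral G u.

Lemma eq_curve_mean (u v : R * R -> R) :
  (forall t, lo <= t <= hi -> u (G t) = v (G t)) -> curve_mean u = curve_mean v.
Proof.
move=> uv; congr (_ * _); apply: eq_Rintegral => t; rewrite inE/= in_itv/=.
exact: uv.
Qed.

Lemma subset_itvoc_curve s t : lo <= s -> t <= hi ->
  `]s, t]%classic `<=` `[lo, hi]%classic.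
Proof.
move=> ls th x /=; rewrite !in_itv/= => /andP[sx xt].
by rewrite (le_trans ls (ltW sx)) (le_trans xt th).
Qed.

Lemma arclength_integral_itvoc (u : R * R -> R) : continuous u ->
  arclength_integral G u = \int[mu]_(t in `]lo, hi]) u (G t).
Proof.
move=> cu; rewrite /arclength_integral /Rintegral.
rewrite (@negligible_integral _ _ _ mu _ [set lo])//.
- by rewrite setDitv1l.
- exact: (@continuous_curve_integrable _ G u `[lo, hi]).
- exact: arclength_measure_lo.
Qed.

Lemma Rintegral_curve_split (u : R * R -> R) r s t : continuous u ->
  lo <= r -> r <= s -> s <= t -> t <= hi ->
  \int[mu]_(x in `]r, t]) u (G x) =
  \int[mu]_(x in `]r, s]) u (G x) + \int[mu]_(x in `]s, t]) u (G x).
Proof.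
move=> cu lr rs st th.
have E : `]r, t]%classic = `]r, s]%classic `|` `]s, t]%classic :> set R.
  by rewrite (@itv_bndbnd_setU _ _ (BRight r) (BRight s))?bnd_simp.
rewrite E Rintegral_setU//.
- rewrite -E; apply: (@continuous_curve_integrable _ G u `]r, t]) => //.
  exact: subset_itvoc_curve.
- rewrite disj_set2E; apply/eqP; rewrite -subset0 => x [] /=.
  by rewrite !in_itv/= => /andP[_ xs] /andP[/lt_le_trans/(_ xs)]; rewrite ltxx.
Qed.

(** Chords are shorter than arcs, so [u] deviates from [u (G r)] by at most [K] times the length of
    the subarc; integrating over the subarc brings in that length once more. *)
Lemma Rintegral_subarc (u : R * R -> R) (K : R) r s t :
  continuous u -> (forall Y Z, `|u Y - u Z| <= K * edist2 Y Z) -> 0 <= K ->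
  lo <= s -> s <= r -> r <= t -> t <= hi ->
  `|\int[mu]_(x in `]s, t]) u (G x) - (F t - F s) * u (G r)|
    <= K * (F t - F s) ^+ 2.
Proof.
move=> cu uK K0 ls sr rt th.
have st := le_trans sr rt.
have Fst : 0 <= F t - F s by rewrite subr_ge0 arclength_fun_nd.
set D := F t - F s in Fst *.
have near_r x : s < x -> x <= t -> `|u (G x) - u (G r)| <= K * D.
  move=> sx xt; apply: (le_trans (uK _ _)); rewrite ler_wpM2l//.
  have lx := le_trans ls (ltW sx).
  have [xr|/ltW rx] := leP x r.
    apply: le_trans (edist2_le_arclength lx xr (le_trans rt th)) _.
    by rewrite /D lerB// arclength_fun_nd// ltW.
  rewrite edist2C.
  apply: le_trans (edist2_le_arclength (le_trans ls sr) rx (le_trans xt th)) _.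
  by rewrite /D lerB// arclength_fun_nd.
have iu : mu.-integrable `]s, t] (EFin \o (u \o G)).
  apply: (@continuous_curve_integrable _ G u `]s, t]) => //.
  exact: subset_itvoc_curve.
have ik k : mu.-integrable `]s, t] (EFin \o (fun=> k)).
  apply: (@continuous_curve_integrable _ G (fun=> k) `]s, t]).
    exact: cst_continuous.
  exact: subset_itvoc_curve.
have mst : measurable (`]s, t]%classic : set (measurableTypeR R)).
  exact: (measurable_itv `]s, t]).
have cstE k : \int[mu]_(x in `]s, t]) k = k * D.
  rewrite Rintegral_cst//; congr (_ * _).
  by have /(congr1 fine) := arclength_measure_itvoc G st.
have h1 : (u (G r) - K * D) * D <= \int[mu]_(x in `]s, t]) u (G x).
  rewrite -cstE; apply: le_Rintegral => // x /=; rewrite in_itv/= => /andP[sx xt].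
  by have /ler_normlP[+ _] := near_r x sx xt; lra.
have h2 : \int[mu]_(x in `]s, t]) u (G x) <= (u (G r) + K * D) * D.
  rewrite -cstE; apply: le_Rintegral => // x /=; rewrite in_itv/= => /andP[sx xt].
  by have /ler_normlP[_] := near_r x sx xt; lra.
move: h1 h2; set I := \int[mu]_(x in _) _; clearbody D I => h1 h2.
by clear -h1 h2; rewrite ler_norml; apply/andP; split; lra.
Qed.

Context (L_gt0 : 0 < L).

Lemma curve_lo_lt_hi : lo < hi.
Proof.
rewrite ltNge; apply: contraL L_gt0 => hl.
by rewrite -arclength_fun_hi arclength_fun_lo// ltxx.
Qed.

Lemma curve_mean_is_mean : is_mean curve_mean.
Proof.
have mI := measurable_itv `[lo, hi].
have int u := @continuous_curve_integrable _ G u `[lo, hi] ^~ (@subset_refl _ _).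
split.
- move=> u v cu cv; rewrite /curve_mean -mulrDr; congr (_ * _).
  by apply: RintegralD => //; exact: int.
- move=> k u cu; rewrite /curve_mean mulrCA; congr (_ * _).
  by apply: RintegralZl => //; exact: int.
- move=> u v cu cv uv; rewrite /curve_mean ler_pM2l ?invr_gt0//.
  by apply: le_Rintegral => //; exact: int.
(* Normalisation: the total mass is [F hi - F lo = L]. *)
- rewrite /curve_mean arclength_integral_itvoc; last exact: cst_continuous.
  rewrite Rintegral_cst; last exact: (measurable_itv `]lo, hi]).
  rewrite mul1r (congr1 fine (arclength_measure_itvoc G (curve_le G)))/=.
  by rewrite arclength_fun_hi arclength_fun_lo// subr0 mulVf// gt_eqF.
Qed.

Lemma arclength_fun_surj r s v : lo <= r -> r <= s -> s <= hi -> F r <= v <= F s ->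
  exists2 t, r <= t <= s & F t = v.
Proof.
move=> lr rs sh /andP[rv vs].
have cF : {within `[r, s], continuous F}.
  apply: continuous_subspaceW (arclength_fun_continuous curve_lo_lt_hi).
  by apply: subset_itv; rewrite bnd_simp.
have [|t] := IVT rs cF (v := v); first by rewrite ge_min rv le_max vs orbT.
by rewrite in_itv; exists t.
Qed.

(* Cut the curve into m arcs of length L / m, with the foci at cut points. *)
Lemma curve_mean_discretization (m : nat) : (0 < m)%N ->
  exists P : 'I_m -> R * R, forall X,
    `|curve_mean (edist2 X) - m%:R^-1 * \sum_(i < m) edist2 X (P i)| <= L / m%:R.
Proof.
move=> m0; have m0' : 0 < m%:R :> R by rewrite ltr0n.
set d := L / m%:R; have d0 : 0 < d by rewrite divr_gt0.
(* There are [m + 1] cut points, of which the first [m] carry foci; indices beyond [m] get the dummy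
   value [0]. *)
have /choice[t tP] : forall i, exists t, (i <= m)%N -> lo <= t <= hi /\ F t = i%:R * d.
  move=> i; have [im|im] := leqP i m; last by exists 0.
  have [|t tI tv] := @arclength_fun_surj lo hi (i%:R * d) (lexx _) (curve_le G) (lexx _).
    rewrite arclength_fun_lo// arclength_fun_hi (mulr_ge0 _ (ltW d0))//=.
    by rewrite /d mulrA ler_pdivrMr// mulrC ler_wpM2l ?ler_nat// ltW.
  by exists t.
exists (fun i => G (t i)) => X.
have cX := @edist2_continuous R X.
have lipX Y Z : `|edist2 X Y - edist2 X Z| <= 1 * edist2 Y Z.
  by rewrite mul1r edist2_lipschitz.
(* Each arc costs at most [d ^+ 2], so all [m] arcs cost [L * d], and the division by [L] leaves
   [d]. *)
have partial k : (k <= m)%N ->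
    `|\int[mu]_(x in `]lo, t k]) edist2 X (G x) - \sum_(i < k) d * edist2 X (G (t i))|
      <= k%:R * d ^+ 2.
  elim: k => [_|k ih km].
    (* [F] may be constant near [lo], so [t 0] need not be [lo]; the arc before it has length zero
       and contributes nothing. *)
    have [/andP[lt th] Ft] := tP 0%N (leq0n _).
    have := Rintegral_subarc cX lipX ler01 (lexx _) lt (lexx _) th.
    by rewrite Ft arclength_fun_lo// big_ord0 !(mul0r, subr0, mulr0, expr0n).
  have [/andP[lt th] Ft] := tP k (ltnW km).
  have [/andP[lt' th'] Ft'] := tP k.+1 km.
  have tt : t k <= t k.+1.
    rewrite leNgt; apply/negP => /ltW /(@arclength_fun_nd _ G).
    by rewrite Ft Ft' ler_pM2r// ler_nat ltnn.
  rewrite (Rintegral_curve_split cX (lexx _) lt tt th') big_ord_recr/=.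
  have := Rintegral_subarc cX lipX ler01 lt (lexx _) tt th'.
  have -> : F (t k.+1) - F (t k) = d by rewrite Ft Ft' -mulrBl -natrB// subSnn mul1r.
  rewrite mul1r => h; rewrite opprD addrACA.
  apply: (le_trans (ler_normD _ _)).
  by rewrite -natr1 mulrDl mul1r; apply: lerD => //; exact: ih (ltnW km).
have [/andP[lt th] Ft] := tP m (leqnn _).
have FL : m%:R * d = L by rewrite /d mulrC divfK// gt_eqF.
(* Likewise [t m] may precede [hi], but the remaining arc has length zero. *)
have := Rintegral_subarc cX lipX ler01 lt (lexx _) th (lexx _).
rewrite arclength_fun_hi Ft FL subrr mul0r subr0 expr0n mulr0 normr_le0 => /eqP tail.
have := partial m (leqnn m).
rewrite expr2 mulrA FL /curve_mean arclength_integral_itvoc//.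
rewrite (Rintegral_curve_split cX (lexx _) lt th (lexx _)) tail addr0.
set I := \int[mu]_(x in _) _; rewrite -mulr_sumr; set S := \sum_(i < m) _ => h.
have -> : L^-1 * I - m%:R^-1 * S = L^-1 * (I - d * S).
  by rewrite /d; field; rewrite !gt_eqF.
by rewrite normrM gtr0_norm ?invr_gt0// ler_pdivrMl.
Qed.

(* Every arc around a point of the curve has positive length. *)
Lemma curve_mean_eq0 (u : R * R -> R) (K : R) :
  continuous u -> (forall Y Z, `|u Y - u Z| <= K * edist2 Y Z) -> 0 < K ->
  (forall Y, 0 <= u Y) -> curve_mean u = 0 ->
  forall r, lo <= r <= hi -> u (G r) = 0.
Proof.
move=> cu uK K0 u0 mu0 r /andP[lr rh].
apply/eqP/negPn/negP => ur; have {ur}d0 : 0 < u (G r) by rewrite lt_def ur u0.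
(* On an arc around [r] of length at most [2 * h], the error rate [K * (F t - F s)] is at most
   [d / 2], which leaves the integral positive. *)
set d := u (G r) in d0; pose h := d / (4 * K).
have h0 : 0 < h by rewrite divr_gt0// mulr_gt0.
have Flo : F lo = 0 by exact: arclength_fun_lo.
have Fr0 : 0 <= F r by rewrite -Flo arclength_fun_nd.
have FrL : F r <= L by rewrite -arclength_fun_hi arclength_fun_nd.
(* The arc is truncated to the range [[0, L]] of [F], since [r] may be close to an end; its length
   stays positive because [L] and [h] are. *)
have [|s /andP[ls sr] Fs] := @arclength_fun_surj lo r (Num.max 0 (F r - h)) (lexx _) lr rh.
  by rewrite Flo le_max lexx ge_max Fr0 gerBl (ltW h0).
have [|t /andP[rt th] Ft] := @arclength_fun_surj r hi (Num.min L (F r + h)) lr rh (lexx _).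
  by rewrite arclength_fun_hi ge_min lexx le_min FrL lerDl (ltW h0).
have hK : K * h = d / 4 by rewrite /h; field; rewrite gt_eqF.
have Dle : F t - F s <= 2 * h.
  rewrite Fs Ft; have : Num.min L (F r + h) <= F r + h by rewrite ge_min lexx orbT.
  have : F r - h <= Num.max 0 (F r - h) by rewrite le_max lexx orbT.
  lra.
have Dgt : 0 < F t - F s.
  rewrite subr_gt0 Fs Ft lt_min !gt_max L_gt0/=; apply/and3P; split; lra.
have st := le_trans sr rt.
have := Rintegral_subarc cu uK (ltW K0) ls sr rt th.
move=> /ler_normlP[+ _]; rewrite -/d => h1.
have : 0 < \int[mu]_(x in `]s, t]) u (G x).
  apply: (@lt_le_trans _ _ ((F t - F s) * (d - K * (F t - F s)))); last first.
    by move: h1; rewrite expr2; nra.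
  by rewrite mulr_gt0//; nra.
have : 0 <= \int[mu]_(x in `]lo, s]) u (G x) by apply: Rintegral_ge0 => ? _.
have : 0 <= \int[mu]_(x in `]t, hi]) u (G x) by apply: Rintegral_ge0 => ? _.
move: mu0 => /eqP; rewrite /curve_mean mulf_eq0 invr_eq0 gt_eqF//= => /eqP.
rewrite arclength_integral_itvoc//.
rewrite (Rintegral_curve_split cu (lexx _) ls (le_trans sr rh) (lexx _)).
rewrite (Rintegral_curve_split cu ls st th (lexx _)).
lra.
Qed.

End curve_mean.

Lemma finite_mean_is_mean (R : realType) (m : nat) (P : 'I_m -> R * R) :
  (0 < m)%N -> is_mean (fun u => m%:R^-1 * \sum_(i < m) u (P i)).
Proof.
move=> m0; have m0' : 0 < m%:R :> R by rewrite ltr0n.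
split.
- by move=> u v _ _; rewrite big_split mulrDr.
- by move=> k u _; rewrite -mulr_sumr mulrCA.
- by move=> u v _ _ uv; rewrite ler_pM2l ?invr_gt0// ler_sum.
- by rewrite sumr_const card_ord mulVf// gt_eqF.
Qed.

(** * Uniqueness of the minimizer of the mean distance *)

Section unique_minimizer.
Context {R : realType} (G : rectifiable_curve R).
Context (L_gt0 : 0 < curve_length G).

(** Minimality at the midpoint [M] makes the nonnegative convexity defect [phi] have mean zero, so
    it vanishes on the curve. There the difference [psi] of the distances to [Q] and [P] has
    absolute value [edist2 P Q]; being constant with mean [c - c = 0], it vanishes. *)
Lemma mean_distance_minimizer_unique (c : R) (P Q : R * R) :
  (forall X, c <= mean_distance G X) ->
  mean_distance G P = c -> mean_distance G Q = c -> P = Q.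
Proof.
move=> cmin Pc Qc; apply: edist2_eq0.
have mG := curve_mean_is_mean L_gt0; have [mD mZ mle _] := mG.
have ce X := @edist2_continuous R X.
set M := line P Q 2^-1.
pose phi Z := (edist2 P Z + edist2 Q Z) + (- 2) * edist2 M Z.
have cPQ := continuousD_real (ce P) (ce Q).
have cM := continuousZ_real (k := - 2) (ce M).
have cphi : continuous phi by exact: continuousD_real.
have phi0 Z : 0 <= phi Z.
  have := edist2_convex P Q Z (t := 2^-1); rewrite /phi -/M; lra.
have mphi : curve_mean G phi = 0.
  apply/eqP; rewrite eq_le; apply/andP; split.
    rewrite /phi mD// mD// mZ//.
    have := cmin M; rewrite /curve_mean -!/(mean_distance G _) Pc Qc; lra.
  by rewrite -[X in X <= _](mean_cst mG); apply: mle => //; exact: cst_continuous.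
(* The Lipschitz constants [1], [1] and [2] of the three terms add up to [4]. *)
have phiK Y Z : `|phi Y - phi Z| <= 4 * edist2 Y Z.
  have /ler_normlP[? ?] := edist2_lipschitz P Y Z.
  have /ler_normlP[? ?] := edist2_lipschitz Q Y Z.
  have /ler_normlP[? ?] := edist2_lipschitz M Y Z.
  by rewrite ler_norml /phi; apply/andP; split; lra.
have phiG := curve_mean_eq0 L_gt0 cphi phiK (ltr0Sn _ _) phi0 mphi.
pose psi Z := edist2 Q Z + (- 1) * edist2 P Z.
have cP1 := continuousZ_real (k := - 1) (ce P).
have cpsi : continuous psi by exact: continuousD_real.
have psiG t : curve_lo G <= t <= curve_hi G -> `|psi (G t)| = edist2 P Q.
  move=> /phiG; rewrite /phi /psi mulN1r => h; apply: edist2_midpoint_eq.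
  by rewrite -/M; lra.
have lo_in : curve_lo G <= curve_lo G <= curve_hi G by rewrite lexx curve_le.
(* The curve is connected, so psi has a constant sign along it. *)
have psi_cst t : curve_lo G <= t <= curve_hi G -> psi (G t) = psi (G (curve_lo G)).
  move=> tI; have /andP[lt th] := tI.
  have cpsiG : {within `[curve_lo G, t], continuous (psi \o G)}.
    apply: (@continuous_subspaceW _ _ _ `[curve_lo G, curve_hi G]).
      by apply: subset_itvl; rewrite bnd_simp.
    move=> y; apply: (@continuous_comp (subspace _) _ _ G psi).
      exact: curve_continuous.
    exact: cpsi.
  have [->//|ne] := eqVneq (psi (G t)) (psi (G (curve_lo G))).
  have opp : psi (G t) = - psi (G (curve_lo G)).
    have /eqP : `|psi (G t)| = `|psi (G (curve_lo G))| by rewrite !psiG.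
    by rewrite eqr_norm2 (negPf ne) => /eqP.
  (* Opposite values force a zero of [psi] in between; since its absolute value is constant on the
     curve, both end values are then [0], hence equal. *)
  have [|s] := IVT lt cpsiG (v := 0).
    rewrite /= opp; apply/andP; split.
      by rewrite ge_min oppr_le0 le_total.
    by rewrite le_max oppr_ge0 le_total.
  rewrite in_itv/= => /andP[ls st] psis0.
  have := psiG s; rewrite ls (le_trans st th) psis0 normr0 => /(_ isT) V0.
  have := psiG t tI; rewrite -V0 => /eqP; rewrite normr_eq0 => /eqP ->.
  by have := psiG _ lo_in; rewrite -V0 => /eqP; rewrite normr_eq0 => /eqP ->.
have psi0 : curve_mean G psi = 0.
  rewrite /psi mD// mZ// /curve_mean -!/(mean_distance G _) Pc Qc; lra.
rewrite -(psiG _ lo_in) -(mean_cst mG (psi _)) -[RHS](normr0 R) -psi0.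
by congr `|_|; apply/esym/eq_curve_mean.
Qed.

End unique_minimizer.

Theorem mainTheorem2 (R : realType) (Gamma : rectifiable_curve R)
  (hL : 0 < curve_length Gamma) (c : R)
  (hc : [set X | mean_distance Gamma X = c] !=set0) :
  exists P : nat -> set (R * R),
    (forall n, is_polyellipse (P n)) /\
    hausdorff_distance (P n) [set X | mean_distance Gamma X = c]
      @[n --> \oo] --> 0%E.
Proof.
have mG := curve_mean_is_mean hL.
have [[x0 /= x0c]|/forallNP cmin] :=
    pselect (exists x0, curve_mean Gamma (edist2 x0) < c); last first.
  have {}cmin X : c <= mean_distance Gamma X by rewrite leNgt; exact/negP/cmin.
  have [P Pc] := hc.
  have -> : [set X | mean_distance Gamma X = c] = [set P].
    apply/seteqP; split => [X /= Xc|X ->//].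
    exact: (mean_distance_minimizer_unique hL cmin).
  have self (e : R) : 0 <= e -> forall X, [set P] X ->
      exists2 Y, [set P] Y & edist2 X Y <= e.
    by move=> e0 _ ->; exists P => //; rewrite edist2xx.
  exists (fun=> [set P]); split => [n|].
    split; first by exists P.
    (* A single point is the polyellipse with one focus at that point and constant [0]. *)
    exists 1%N, (fun=> P), 0; split => //; apply/seteqP; split => X /=.
      by move=> ->; rewrite big_ord1 edist2xx.
    by rewrite big_ord1 => /edist2_eq0.
  have -> : hausdorff_distance [set P] [set P] = 0%E; last exact: cvg_cst.
  apply/eqP; rewrite eq_le hausdorff_distance_ge0 ?andbT; last by exists P.
  apply: hausdorff_distance_le; first exact: self.
  by move=> _ ->; exists P => //; rewrite edist2xx.
(* Stage [n] uses [n.+1] foci, so that their number is never zero. *)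
have [P PP] : exists P : forall n, 'I_n.+1 -> R * R, forall n X,
    `|curve_mean Gamma (edist2 X) - n.+1%:R^-1 * \sum_(i < n.+1) edist2 X (P n i)|
      <= curve_length Gamma / n.+1%:R.
  have h n := cid (curve_mean_discretization hL (ltn0Sn n)).
  by exists (fun n => sval (h n)) => n; exact: svalP (h n).
set L := curve_length Gamma in PP *.
pose e (n : nat) : R := L / n.+1%:R.
have ecvg : e n @[n --> \oo] --> (0 : R).
  rewrite -(mulr0 L); apply: cvgM; first exact: cvg_cst.
  exact: cvg_harmonic.
set d := c - curve_mean Gamma (edist2 x0).
have d0 : 0 < d by rewrite subr_gt0.
have [N _ small] : \forall n \near \oo, 2 * e n <= d.
  have : \forall n \near \oo, `|0 - e n| < d / 2.
    by move/cvgrPdist_lt : ecvg; apply; rewrite divr_gt0.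
  apply: filterS => n; rewrite sub0r normrN => /(le_lt_trans (ler_norm _)); lra.
pose B n u := n.+1%:R^-1 * \sum_(i < n.+1) u (P n i) : R.
have mB n : is_mean (B n) by exact: finite_mean_is_mean.
pose Q n := [set X | B n (edist2 X) = c].
have Q0 n : (N <= n)%N -> Q n !=set0.
  move=> Nn; have [X Xc] := hc.
  have [|Y Yc _] := nearby_level_point mG (mB n) (PP n) x0c _ Xc.
    have := small n Nn; have : 0 <= e n by rewrite divr_ge0// ltW.
    rewrite -/d /= -/(e n); lra.
  by exists Y.
have QH n : (N <= n)%N ->
    (hausdorff_distance (Q n) [set X | mean_distance Gamma X = c]
      <= (4 * c / d * e n)%:E)%E.
  move=> Nn; apply: (level_set_hausdorff_le mG (mB n) (PP n) x0c).
  exact: small.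
(* The shift by [N] skips the early stages, whose level sets might be empty. Multiplying [c] by the
   number of foci turns a level of the mean into a level of the sum. *)
exists (fun n => Q (n + N)%N); split => [n|].
  split; first exact: Q0 (leq_addl _ _).
  exists (n + N).+1, (P (n + N)%N), ((n + N).+1%:R * c); split => //.
  have n0 : (n + N).+1%:R != 0 :> R by rewrite pnatr_eq0.
  apply/seteqP; split => X; rewrite /Q /B /=.
    by move=> <-; rewrite mulVKf.
  by move=> ->; rewrite mulKf.
apply: (@squeeze_cvge _ _ _ _ (cst 0%E) _ (fun n => (4 * c / d * e (n + N)%N)%:E)).
- near=> n; rewrite hausdorff_distance_ge0 ?QH ?leq_addl//.
  by apply: Q0; exact: leq_addl.
- exact: cvg_cst.
- apply: cvg_EFin; first by near=> n.
  rewrite -(mulr0 (4 * c / d)); apply: cvgM; first exact: cvg_cst.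
  by rewrite (cvg_shiftn N).
Unshelve. all: by end_near. Qed.
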